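(* Let $\nu=\mu$ with $\mu$ satisfying the standing assumptions. There exists a constant $C_{\mathsf{lb}}>0$ such that for any $\varepsilon>0$ we have $$\operatorname{dist}(\operatorname{spt}\pi_\varepsilon;\operatorname{spt}\pi_\star)\ge C_{\mathsf{lb}}\min\big(\delta_{\mathsf{ST}}^{1/2}(\varepsilon),\operatorname{diam}(\operatorname{spt}\mu)\big).$$ More precisely, there exists $(x,y)\in\operatorname{spt}\pi_\varepsilon$ satisfying $$\|x-y\|\ge\sqrt2\,C_{\mathsf{lb}}\min\big(\delta_{\mathsf{ST}}^{1/2}(\varepsilon),\operatorname{diam}(\operatorname{spt}\mu)\big).$$
   Context: Work in $\mathbb R^d$, $d\in\mathbb N$, with Euclidean norm; $B(x,r)$ is the open ball and $\operatorname{diam}(A)=\sup_{x,y\in A}\|x-y\|$. Standing assumptions: $\mu$ is a Borel probability measure on $\mathbb R^d$, absolutely continuous with respect to Lebesgue measure, $\operatorname{spt}\mu\subseteq B(0,1)$, and the interior of $\operatorname{spt}\mu$ is connected. Self-transport setting: $\nu=\mu$. Put $c(x,y)=\tfrac12\|x-y\|^2$ and $\mathbb P=\mu\otimes\nu$ (so $\operatorname{spt}\mathbb P=\operatorname{spt}\mu\times\operatorname{spt}\nu$). Improved $\varepsilon$-spread: $\delta_{\mathsf{ST}}(\varepsilon):=\inf\{r>0: r\cdot\rho(\sqrt r)>\varepsilon\}$, where $\rho(r):=\inf_{x\in\operatorname{spt}\mu}\mu(B(x,r))$. Quadratically regularized optimal transport: for $\varepsilon>0$, $\pi_\varepsilon$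 is the unique minimizer over couplings $\pi$ of $\mu$ and $\nu$ of $\int c\,d\pi+\frac{\varepsilon}{2}\|\frac{d\pi}{d\mathbb P}\|^2_{L^2(\mathbb P)}$. It has density $\frac{d\pi_\varepsilon}{d\mathbb P}(x,y)=\frac1\varepsilon[f_\varepsilon(x)+g_\varepsilon(y)-c(x,y)]_+$, where the optimal dual potentials $f_\varepsilon,g_\varepsilon:\mathbb R^d\to\mathbb R$ are continuous and determined, up to a constant shift $(f_\varepsilon+a,g_\varepsilon-a)$, by $$\int[f_\varepsilon(x)+g_\varepsilon(y)-c(x,y)]_+\,\mu(dx)=\varepsilon\ \ \forall y\in\mathbb R^d,\qquad \int[f_\varepsilon(x)+g_\varepsilon(y)-c(x,y)]_+\,\nu(dy)=\varepsilon\ \ \forall x\in\mathbb R^d.$$ The support of $\pi_\varepsilon$ is $\operatorname{spt}\pi_\varepsilon:=\overline{\{(x,y)\in\operatorname{spt}\mathbb P: f_\varepsilon(x)+g_\varepsilon(y)>c(x,y)\}}$. The unregularized optimal coupling $\pi_\star$ (minimizer of $\int c\,d\pi$ over couplings of $\mu$ and $\nu=\mu$) has $\operatorname{spt}\pi_\star=\{(x,x):x\in\operatorname{spt}\mu\}$. For $A,B\subseteq\mathbb R^d\times\mathbb R^d$, $\operatorname{dist}(A;B):=\sup_{a\in A}\inf_{b\in B}\|a-b\|$ (Euclidean norm on $\mathbb R^d\times\mathbb R^d$).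
   Formalization: The formal theorem additionally assumes that spt μ itself is connected (not only its interior); without this the claim fails when spt μ has separated pieces of positive measure with empty interior, such as small fat Cantor clusters accumulating at the main part. *)

(* Defs.v *)
From HB Require Import structures.
From mathcomp Require Import all_boot all_order all_algebra.
From mathcomp Require Import all_classical all_reals all_analysis.

Set Implicit Arguments.
Unset Strict Implicit.
Unset Printing Implicit Defensive.

Import Order.TTheory GRing.Theory Num.Theory.
Import numFieldNormedType.Exports.
Local Open Scope classical_set_scope.
Local Open Scope ring_scope.

(* R^d is 'rV[R]_d; here it receives its Borel sigma-algebra. *)
Section borel_rV.
Context (R : realType) (d : nat).
Let G : set (set 'rV[R]_d) := open.

HB.instance Definition _ := @isMeasurable.Build (sigma_display G)
  'rV[R]_d <<s G >> (@sigma_algebra0 _ setT G) (@sigma_algebraC _ G)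
  (@sigma_algebra_bigcup _ setT G).

End borel_rV.

Section euclidean.
Context {R : realType} {d : nat}.
Implicit Types (x y : 'rV[R]_d) (z w : 'rV[R]_d * 'rV[R]_d).

(* The library norm `|x| on 'rV[R]_d is the sup norm, hence this definition. *)
Definition enorm x : R := Num.sqrt (\sum_(i < d) x ord0 i ^+ 2).

Definition eball x (r : R) : set 'rV[R]_d := [set y | enorm (y - x) < r].

(* Real supremum: meaningful for nonempty bounded A. *)
Definition diam (A : set 'rV[R]_d) : R :=
  sup [set enorm (xy.1 - xy.2) | xy in A `*` A].

Definition enorm2 z : R := Num.sqrt (enorm z.1 ^+ 2 + enorm z.2 ^+ 2).

Definition dist (A B : set ('rV[R]_d * 'rV[R]_d)) : \bar R :=
  ereal_sup [set ereal_inf [set (enorm2 (a - b))%:E | b in B] | a in A].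

Definition cost x y : R := 2^-1 * enorm (x - y) ^+ 2.

(* Lebesgue outer measure, by countable covers by half-open boxes; on Borel
   sets this is d-dimensional Lebesgue measure (for 0 < d). *)
Definition box x y : set 'rV[R]_d :=
  [set u | forall i, x ord0 i < u ord0 i <= y ord0 i].

Definition box_volume x y : R := \prod_(i < d) Num.max 0 (y ord0 i - x ord0 i).

Definition lebesgue_outer (A : set 'rV[R]_d) : \bar R :=
  ereal_inf [set (\sum_(0 <= k <oo) (box_volume (a k).1 (a k).2)%:E)%E |
    a in [set a : nat -> 'rV[R]_d * 'rV[R]_d |
            A `<=` \bigcup_k box (a k).1 (a k).2]].

End euclidean.

Definition spt {R : realType} {T : topologicalType} (m : set T -> \bar R) :
  set T := [set x | forall U, open_nbhs x U -> (0 < m U)%E].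

Section spread.
Context {R : realType} {d : nat} (mu : probability 'rV[R]_d R).

Definition rho (r : R) : R := inf [set fine (mu (eball x r)) | x in spt mu].

Definition delta_ST (eps : R) : R :=
  inf [set r : R | 0 < r /\ eps < r * rho (Num.sqrt r)].

End spread.

Section transport.
Context {R : realType} {d : nat}.
Implicit Types (mu nu : probability 'rV[R]_d R).
Implicit Types (pi : probability ('rV[R]_d * 'rV[R]_d)%type R).
Implicit Types (f g : 'rV[R]_d -> R).
Local Open Scope ereal_scope.

Definition coupling mu nu pi : Prop :=
  forall A : set 'rV[R]_d, measurable A ->
    pi (A `*` setT) = mu A /\ pi (setT `*` A) = nu A.

Definition transport_cost pi : \bar R := \int[pi]_z (cost z.1 z.2)%:E.

Definition ot_plan mu nu pi : Prop :=
  coupling mu nu pi /\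
  forall pi', coupling mu nu pi' -> transport_cost pi <= transport_cost pi'.

Definition prodP mu nu : probability ('rV[R]_d * 'rV[R]_d)%type R := mu \x nu.

Definition density mu nu pi : 'rV[R]_d * 'rV[R]_d -> \bar R :=
  Radon_Nikodym (charge_of_finite_measure pi) (prodP mu nu).

(* The L^2 penalty is +oo when pi is not absolutely continuous with respect
   to prodP mu nu; in that case Radon_Nikodym is a default value. *)
Definition qot_cost (eps : R) mu nu pi : \bar R :=
  transport_cost pi +
  if `[< pi `<< prodP mu nu >]
  then (eps / 2)%:E * 'N[prodP mu nu]_2%:E[density mu nu pi] ^+ 2
  else +oo.

Definition qot_plan (eps : R) mu nu pi : Prop :=
  coupling mu nu pi /\
  forall pi', coupling mu nu pi' ->
    qot_cost eps mu nu pi <= qot_cost eps mu nu pi'.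

Definition slack f g (x y : 'rV[R]_d) : R := (f x + g y - cost x y)%R.

Definition dual_potentials (eps : R) mu nu f g : Prop :=
  [/\ continuous f, continuous g,
      forall y, \int[mu]_x (Num.max 0%R (slack f g x y))%:E = eps%:E &
      forall x, \int[nu]_y (Num.max 0%R (slack f g x y))%:E = eps%:E].

Definition qot_solution (eps : R) mu nu pi f g : Prop :=
  [/\ qot_plan eps mu nu pi, dual_potentials eps mu nu f g &
      {ae prodP mu nu, forall z,
        density mu nu pi z = (eps^-1 * Num.max 0%R (slack f g z.1 z.2))%:E}].

Definition qot_spt mu nu f g : set ('rV[R]_d * 'rV[R]_d) :=
  closure [set z | spt (prodP mu nu) z /\ (cost z.1 z.2 < f z.1 + g z.2)%R].

End transport.

(* Main.v *)
Require Import Defs.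
From HB Require Import structures.
From mathcomp Require Import all_boot all_order all_algebra.
From mathcomp Require Import all_classical all_reals all_analysis.
From mathcomp Require Import measurable_realfun ring lra.

Set Implicit Arguments.
Unset Strict Implicit.
Unset Printing Implicit Defensive.

Import Order.TTheory GRing.Theory Num.Theory.
Import numFieldNormedType.Exports.
Local Open Scope classical_set_scope.
Local Open Scope ring_scope.

(** Why the bound holds, with the constant 1/10 for every measure.

    Write [m] for the minimum of the square root of [delta_ST mu eps] and the
    diameter of the support, and suppose that every pair of support points with
    positive slack [f x + g y - cost x y] is closer than [L = sqrt 2 / 10 * m].
    Three facts then bound the slack by a multiple of [L ^ 2].

    - The marginal equation forces [g] to grow slowly: moving [y] to [y'] raises
      the cost by at most [|y - y'| (2 L + |y - y'|) / 2] at those [x] where the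
      slack is positive, so a larger increase of [g] would strictly increase
      the integral of the positive part of the slack, which is always [eps]
      ([pospart_integral_gap], [potential_growth]).
    - Since [2 L] is less than the diameter and the support is connected, every
      support point [x] has a support point [y] at distance exactly [L]
      ([connected_sphere]); there the slack is nonpositive, so
      [f x + g y <= L ^ 2 / 2].
    - A point [z] with positive slack against [x] is within [2 L] of that [y],
      hence its slack is at most [4 L ^ 2 + L ^ 2 / 2] ([slack_upper]).

    The slack of [x] lives in the ball of radius [L] around [x], so integrating
    gives [eps <= 9/2 L ^ 2 mu(B(x, L))] for all support points [x]
    ([eps_le_mass]).  By definition of the spread this yields
    [delta_ST mu eps <= 9 L ^ 2] ([delta_ST_le]), whereas [L ^ 2 = m ^ 2 / 50] is
    at most [delta_ST mu eps / 50]: a contradiction.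

    As for the distance to the support of the unregularized plan, the coupling
    carried by the diagonal costs nothing, so an optimal plan costs nothing and
    its support lies on the diagonal ([spt_ot_plan_self]); and a pair [(x, y)] is
    at distance at least [|x - y| / sqrt 2] from the diagonal. *)

(** * Euclidean norm and quadratic cost *)

Section euclidean_norm.
Context {R : realType} {d : nat}.
Implicit Types x y z : 'rV[R]_d.

Lemma enorm_ge0 x : 0 <= enorm x.
Proof. exact: sqrtr_ge0. Qed.

Lemma enorm_sqr x : enorm x ^+ 2 = \sum_(i < d) x ord0 i ^+ 2.
Proof. by rewrite sqr_sqrtr// sumr_ge0// => i _; exact: sqr_ge0. Qed.

Lemma enorm0 : enorm (0 : 'rV[R]_d) = 0.
Proof. by rewrite /enorm big1 ?sqrtr0// => i _; rewrite mxE expr0n. Qed.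

Lemma enorm_eq0 x : enorm x = 0 -> x = 0.
Proof.
move=> x0; apply/rowP => i; rewrite mxE; apply/eqP; rewrite -sqrf_eq0.
have /eqP := enorm_sqr x; rewrite x0 expr0n eq_sym psumr_eq0; last first.
  by move=> j _; exact: sqr_ge0.
by move=> /allP/(_ i); rewrite mem_index_enum => /(_ isT).
Qed.

Lemma enormB x y : enorm (x - y) = enorm (y - x).
Proof.
by rewrite /enorm; congr Num.sqrt; apply: eq_bigr => i _; rewrite !mxE -sqrrN opprB.
Qed.

(** Cauchy-Schwarz: expand [0 <= |b x - a y| ^ 2] with [a = |x|] and [b = |y|],
    then divide by [2 a b]. *)
Lemma dot_le_enorm x y :
  \sum_(i < d) x ord0 i * y ord0 i <= enorm x * enorm y.
Proof.
have [x0|x0] := eqVneq (enorm x) 0.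
  by rewrite x0 mul0r (enorm_eq0 x0) big1// => i _; rewrite mxE mul0r.
have [y0|y0] := eqVneq (enorm y) 0.
  by rewrite y0 mulr0 (enorm_eq0 y0) big1// => i _; rewrite mxE mulr0.
set a := enorm x; set b := enorm y.
have ab : 0 < a * b by rewrite mulr_gt0// lt_neqAle enorm_ge0 eq_sym ?x0 ?y0.
have : 0 <= \sum_(i < d) (b * x ord0 i - a * y ord0 i) ^+ 2.
  by apply: sumr_ge0 => i _; exact: sqr_ge0.
have -> : \sum_(i < d) (b * x ord0 i - a * y ord0 i) ^+ 2 =
    b ^+ 2 * a ^+ 2 + a ^+ 2 * b ^+ 2
    - 2 * (a * b) * \sum_(i < d) x ord0 i * y ord0 i.
  rewrite [X in b ^+ 2 * X]enorm_sqr [X in a ^+ 2 * X]enorm_sqr !mulr_sumr.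
  rewrite -sumrN -!big_split/=.
  by apply: eq_bigr => i _; ring.
have -> : b ^+ 2 * a ^+ 2 + a ^+ 2 * b ^+ 2 = 2 * (a * b) * (a * b) by ring.
by rewrite -mulrBr pmulr_rge0 ?subr_ge0// mulr_gt0.
Qed.

Lemma ler_enormD x y : enorm (x + y) <= enorm x + enorm y.
Proof.
rewrite -(@ler_pXn2r _ 2)// ?nnegrE ?addr_ge0 ?enorm_ge0//.
rewrite sqrrD !enorm_sqr.
have -> : \sum_(i < d) (x + y) ord0 i ^+ 2 = \sum_(i < d) x ord0 i ^+ 2 +
   (\sum_(i < d) x ord0 i * y ord0 i) *+ 2 + \sum_(i < d) y ord0 i ^+ 2.
  rewrite -sumrMnl -!big_split/=; apply: eq_bigr => i _.
  by rewrite mxE sqrrD.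
by rewrite lerD2r lerD2l lerMn2r/= dot_le_enorm.
Qed.

Lemma enorm_triangle y x z : enorm (x - z) <= enorm (x - y) + enorm (y - z).
Proof. by rewrite -{1}(subrK y x) -addrA ler_enormD. Qed.

Lemma continuous_enorm : continuous (@enorm R d).
Proof.
move=> x; apply: continuous_comp; last exact: sqrt_continuous.
move: x; apply: continuous_big => [|i _ x]; first exact: add_continuous.
apply: (continuous_comp (g := fun t : R => t ^+ 2));
  [exact: coord_continuous|exact: exprn_continuous].
Qed.

Lemma continuous_enorm_sub x : continuous (fun y => enorm (x - y)).
Proof.
move=> y; apply: continuous_comp; last exact: continuous_enorm.
by apply: continuousB => //; exact: cst_continuous.
Qed.

Lemma open_eball x (r : R) : open (eball x r).
Proof.
have -> : eball x r = (fun y => enorm (x - y)) @^-1` [set t | t < r].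
  by apply/seteqP; split => y; rewrite /eball/= enormB.
by apply: open_comp; [move=> y _; exact: continuous_enorm_sub|exact: open_lt].
Qed.

Lemma continuous_cost : continuous (fun z : 'rV[R]_d * 'rV[R]_d => cost z.1 z.2).
Proof.
move=> z; rewrite /cost.
have cn : {for z, continuous (fun z : 'rV[R]_d * 'rV[R]_d => enorm (z.1 - z.2))}.
  apply: continuous_comp; last exact: continuous_enorm.
  by apply: continuousB; [exact: cvg_fst|exact: cvg_snd].
have c2 : {for z, continuous (fun=> 2^-1 : R)} by exact: cst_continuous.
exact: (continuousM c2 (continuousM cn cn)).
Qed.

Lemma continuous_slack (f g : 'rV[R]_d -> R) x : continuous g ->
  continuous (slack f g x).
Proof.
move=> cg y.
have cf : {for y, continuous (fun=> f x)} by exact: cst_continuous.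
have cc : {for y, continuous (cost x)}.
  have c2 : {for y, continuous (fun=> 2^-1 : R)} by exact: cst_continuous.
  have cn := @continuous_enorm_sub x y.
  exact: (continuousM c2 (continuousM cn cn)).
exact: (continuousB (continuousD cf (cg y)) cc).
Qed.

Lemma costC x y : cost x y = cost y x.
Proof. by rewrite /cost enormB. Qed.

End euclidean_norm.

(** * Borel sets and supports *)

Section supports.
Context {R : realType} {d : nat}.
Implicit Types x y z : 'rV[R]_d.

(** A countable base of the topology: sup-norm balls with rational centre. *)
Definition qbox (i : 'rV[rat]_d * nat) : set 'rV[R]_d :=
  ball (map_mx ratr i.1 : 'rV[R]_d) i.2.+1%:R^-1.

Lemma open_qbox i : open (qbox i).
Proof. by apply: ball_open; rewrite invr_gt0. Qed.

Lemma qbox_nbhs x (U : set 'rV[R]_d) : nbhs x U ->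
  exists i, qbox i x /\ qbox i `<=` U.
Proof.
move=> /nbhs_ballP[e /= e0 eU].
pose n := Num.truncn (e / 2)^-1.
have n0 : 0 < n.+1%:R^-1 :> R by rewrite invr_gt0.
have ne : n.+1%:R^-1 < e / 2.
  by rewrite invf_plt ?posrE ?divr_gt0// truncnS_gt.
have /choice[q qP] : forall j, exists q : rat, `|x ord0 j - ratr q| < n.+1%:R^-1.
  move=> j.
  have [q] : exists q, ratr q \in `](x ord0 j - n.+1%:R^-1), (x ord0 j + n.+1%:R^-1)[.
    by apply: rat_in_itvoo; rewrite ltrBlDr -addrA ltrDl addr_gt0.
  rewrite in_itv/= => /andP[h1 h2]; exists q.
  by rewrite ltr_distl ltrBlDr h2 -ltrBlDr h1.
exists (\row_j q j, n); have bx : qbox (\row_j q j, n) x.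
  split => // i j; rewrite (ord1 i) !mxE /ball/= distrC; exact: qP.
split => // y xy; apply: eU.
have -> : e = e / 2 + e / 2 by lra.
apply: (@ball_triangle _ _ (map_mx ratr (\row_j q j) : 'rV[R]_d)).
  by apply/ball_sym; apply: le_ball bx; exact: ltW.
by apply: le_ball xy; exact: ltW.
Qed.

Lemma open_measurable_rV (U : set 'rV[R]_d) : open U -> measurable U.
Proof. exact: sub_gen_smallest. Qed.

(** Open sets of the product topology belong to the product sigma-algebra
    because the base is countable: they are countable unions of rectangles. *)
Lemma open_measurable_prod (W : set ('rV[R]_d * 'rV[R]_d)) :
  open W -> measurable W.
Proof.
move=> oW.
pose F (ij : ('rV[rat]_d * nat) * ('rV[rat]_d * nat)) :=
  if `[< qbox ij.1 `*` qbox ij.2 `<=` W >] then qbox ij.1 `*` qbox ij.2 else set0.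
have -> : W = \bigcup_ij F ij.
  apply/seteqP; split => [[x y] Wxy|[x y] [[i j] _]]; last first.
    by rewrite /F; case: asboolP => //; exact.
  have [[U V]/= [Ux Vy] UVW] : nbhs (x, y) W by exact: open_nbhs_nbhs.
  have [i [xi iU]] := qbox_nbhs Ux.
  have [j [yj jV]] := qbox_nbhs Vy.
  exists (i, j) => //; rewrite /F asboolT//= => -[a b] [/iU Ua /jV Vb].
  exact: UVW.
apply: countable_bigcupT_measurable => [|[i j]]; first exact: countableP.
rewrite /F; case: ifP => // _.
by apply: measurableX; apply: open_measurable_rV; exact: open_qbox.
Qed.

Lemma measurable_fun_open_preimage dp (T : measurableType dp) (h : T -> R) :
  (forall U, open U -> measurable (h @^-1` U)) -> measurable_fun setT h.
Proof.
move=> oh; apply: (measurability _ (RGenOpens.measurableE R)).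
by move=> _ [_ [a [b ->]] <-]; rewrite setTI; apply: oh; exact: interval_open.
Qed.

Lemma continuous_measurable_rV (h : 'rV[R]_d -> R) :
  continuous h -> measurable_fun setT h.
Proof.
move=> /continuousP ch; apply: measurable_fun_open_preimage => U /ch.
exact: open_measurable_rV.
Qed.

Lemma continuous_measurable_prod (h : 'rV[R]_d * 'rV[R]_d -> R) :
  continuous h -> measurable_fun setT h.
Proof.
move=> /continuousP ch; apply: measurable_fun_open_preimage => U /ch.
exact: open_measurable_prod.
Qed.

(** Every point outside the support lies in a null member of the countable
    base, so the complement is a countable union of null sets. *)
Lemma ae_spt (mu : probability 'rV[R]_d R) :
  {ae mu, forall x, spt mu x}.
Proof.
pose F i := if mu (qbox i) == 0%E then qbox i else set0.
pose G k := if @unpickle ('rV[rat]_d * nat)%type k is Some i then F i else set0.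
apply: (@negligibleS _ _ _ _ (\bigcup_k G k)); last first.
  apply: negligible_bigcup => k; rewrite /G.
  case: unpickle => [i|]; last exact: negligible_set0.
  rewrite /F; case: eqP => [i0|_]; last exact: negligible_set0.
  by exists (qbox i); split => //; apply: open_measurable_rV; exact: open_qbox.
move=> x /= /existsNP[U] /not_implyP[[oU Ux] /negP]; rewrite -leNgt => U0.
have [i [xi iU]] := qbox_nbhs (open_nbhs_nbhs (conj oU Ux)).
exists (pickle i) => //; rewrite /G pickleK /F ifT//.
rewrite -measure_le0 (le_trans _ U0)//; apply: le_measure => //; rewrite inE.
  by apply: open_measurable_rV; exact: open_qbox.
exact: open_measurable_rV.
Qed.

Lemma spt_nonempty (mu : probability 'rV[R]_d R) : spt mu !=set0.
Proof.
apply/set0P/eqP => s0; have := ae_spt mu.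
rewrite s0 => -[N [mN N0 sN]].
have : mu setT = 0%E.
  by apply/eqP; rewrite -measure_le0 -N0 le_measure// ?inE// => x _; apply: sN.
by rewrite probability_setT => /eqP; rewrite onee_eq0.
Qed.

Lemma spt_prodP (mu nu : probability 'rV[R]_d R) x y :
  spt mu x -> spt nu y -> spt (prodP mu nu) (x, y).
Proof.
move=> sx sy W [oW Wxy].
have [[U V]/= [/= Ux Vy] UVW] : nbhs (x, y) W by exact: open_nbhs_nbhs.
have [i [xi iU]] := qbox_nbhs Ux.
have [j [yj jV]] := qbox_nbhs Vy.
have mi := open_measurable_rV (@open_qbox i).
have mj := open_measurable_rV (@open_qbox j).
apply: (@lt_le_trans _ _ (prodP mu nu (qbox i `*` qbox j))).
  have -> : prodP mu nu (qbox i `*` qbox j) = (mu (qbox i) * nu (qbox j))%E.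
    exact: product_measure1E.
  apply: mule_gt0.
    by apply: sx; split => //; exact: open_qbox.
  by apply: sy; split => //; exact: open_qbox.
apply: le_measure; rewrite ?inE.
- exact: measurableX.
- exact: open_measurable_prod.
- by move=> [a b] [/iU Ua /jV Vb]; exact: UVW.
Qed.
End supports.

(** * The unregularized self-transport plan *)

Section self_transport.
Context {R : realType} {d : nat} (mu : probability 'rV[R]_d R).

Let diag (x : 'rV[R]_d) := (x, x).

Let measurable_diag : measurable_fun setT diag.
Proof. by apply: measurable_fun_pair; exact: measurable_id. Qed.

Let diag_mfun := isMeasurableFun.Build _ _ _ _ _ measurable_diag.
Let diag_pack : {mfun 'rV[R]_d >-> ('rV[R]_d * 'rV[R]_d)%type} :=
  HB.pack diag diag_mfun.

Lemma cost_ge0 (x y : 'rV[R]_d) : 0 <= cost x y.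
Proof. by rewrite mulr_ge0// sqr_ge0. Qed.

Lemma measurable_cost :
  measurable_fun setT (fun z : 'rV[R]_d * 'rV[R]_d => (cost z.1 z.2)%:E).
Proof.
apply/measurable_EFinP; apply: continuous_measurable_prod; exact: continuous_cost.
Qed.

(** The image of [mu] under the diagonal map is a competitor of zero cost. *)
Lemma ot_plan_self_cost pi : ot_plan mu mu pi -> transport_cost pi = 0%E.
Proof.
move=> [_ /(_ (distribution mu diag_pack))] opt.
apply/eqP; rewrite eq_le; apply/andP; split; last first.
  by apply: integral_ge0 => z _; rewrite lee_fin cost_ge0.
apply: (le_trans (opt _)).
  move=> A mA; split; congr (mu _); apply/seteqP; split => x //=; first by case.
  by case.
rewrite /transport_cost ge0_integral_distribution.
- by rewrite integral0_eq// => x _; rewrite /= /cost subrr enorm0 expr0n mulr0.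
- exact: measurable_cost.
- by move=> z; rewrite lee_fin cost_ge0.
Qed.

(** Off the diagonal the cost is bounded below by a positive constant near
    [z]; a neighbourhood of positive mass would make the total cost positive. *)
Lemma spt_ot_plan_self pi z : ot_plan mu mu pi -> spt pi z -> z.1 = z.2.
Proof.
move=> /ot_plan_self_cost c0 sz; apply/eqP; apply: contraT => z12.
have cz : 0 < cost z.1 z.2.
  rewrite /cost mulr_gt0// exprn_gt0// lt_neqAle enorm_ge0 andbT eq_sym.
  by apply: contra z12 => /eqP/enorm_eq0/eqP; rewrite subr_eq0.
pose U := [set w : 'rV[R]_d * 'rV[R]_d | cost z.1 z.2 / 2 < cost w.1 w.2].
have oU : open U.
  apply: (@open_comp _ _ _ [set t | cost z.1 z.2 / 2 < t]); last exact: open_gt.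
  by move=> w _; exact: continuous_cost.
have mU := open_measurable_prod oU.
have piU : (0 < pi U)%E.
  by apply: sz; split => //; rewrite /U/= ltr_pdivrMr// ltr_pMr// ltr1n.
have : ((cost z.1 z.2 / 2)%:E * pi U <= 0)%E.
  rewrite -c0 -integral_cst//.
  apply: (@le_trans _ _ (\int[pi]_(w in U) (cost w.1 w.2)%:E)%E).
    apply: ge0_le_integral => //.
    - by move=> w _; rewrite lee_fin divr_ge0// cost_ge0.
    - by apply: measurable_funTS; exact: measurable_cost.
    - by move=> w Uw; rewrite lee_fin ltW.
  apply: ge0_subset_integral => //; first exact: measurable_cost.
  by move=> w _; rewrite lee_fin cost_ge0.
by rewrite leNgt mule_gt0// lte_fin divr_gt0.
Qed.
End self_transport.

(** * Slack of dual potentials whose support stays short the diagonal *)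

Section slack_bounds.
Context {R : realType} {d : nat} (mu : probability 'rV[R]_d R).

Let measurable_pospart (h : 'rV[R]_d -> R) : continuous h ->
  measurable_fun setT (fun x => (Num.max 0 (h x))%:E).
Proof.
move=> ch; apply/measurable_EFinP; apply: measurable_maxr => //.
exact: continuous_measurable_rV.
Qed.

Lemma pospart_integral_witness (h : 'rV[R]_d -> R) :
  continuous h -> (0 < \int[mu]_x (Num.max 0 (h x))%:E)%E ->
  exists2 x, spt mu x & 0 < h x.
Proof.
move=> ch h0; apply: contrapT => noh.
suff : (\int[mu]_x (Num.max 0 (h x))%:E <= \int[mu]_x (cst 0 x))%E.
  by rewrite integral0 leNgt h0.
apply: ae_ge0_le_integral => //.
- by move=> x _; rewrite lee_fin le_max lexx.
- exact: measurable_pospart.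
- apply: filterS (ae_spt mu) => x sx _; rewrite lee_fin ge_max lexx/= leNgt.
  by apply/negP => hx; apply: noh; exists x.
Qed.

(** If [k] exceeds [h] by [t > 0] where [h] is positive, then the integral of
    its positive part is larger by at least [t] times the mass of [{h > 0}];
    that mass is positive, since [{h > 0}] is open and meets the support. *)
Lemma pospart_integral_gap (h k : 'rV[R]_d -> R) (eps t : R) :
  continuous h -> continuous k -> 0 < eps ->
  (\int[mu]_x (Num.max 0 (h x))%:E = eps%:E)%E ->
  (\int[mu]_x (Num.max 0 (k x))%:E <= eps%:E)%E ->
  (forall x, spt mu x -> 0 < h x -> h x + t <= k x) ->
  t <= 0.
Proof.
move=> ch ck eps0 ih ik hk; rewrite leNgt; apply/negP => t0.
pose S := [set x | 0 < h x].
have oS : open S.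
  by apply: (@open_comp _ _ h [set s | 0 < s]); [move=> x _; exact: ch|exact: open_gt].
have mS := open_measurable_rV oS.
have muS : (0 < mu S)%E.
  have [|x sx hx] := @pospart_integral_witness h ch; first by rewrite ih lte_fin.
  exact: sx.
have : (eps%:E + t%:E * mu S <= eps%:E)%E.
  apply: le_trans ik; rewrite -ih.
  have -> : (t%:E * mu S)%E = (\int[mu]_x (t * \1_S x)%:E)%E.
    under eq_integral do rewrite EFinM.
    by rewrite ge0_integralZl_EFin ?ltW// ?integral_indic ?setIT//;
      exact/measurable_EFinP.
  have mt : measurable_fun setT (fun x => (t * \1_S x)%:E).
    by apply/measurable_EFinP; exact: measurable_funM.
  rewrite -ge0_integralD//; first last.
  - by move=> x _; rewrite lee_fin mulr_ge0// ltW.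
  - exact: measurable_pospart.
  - by move=> x _; rewrite lee_fin le_max lexx.
  apply: ae_ge0_le_integral => //.
  - move=> x _; rewrite lee_fin addr_ge0//; first by rewrite le_max lexx.
    by rewrite mulr_ge0// ltW.
  - by apply: emeasurable_funD => //; exact: measurable_pospart.
  - by move=> x _; rewrite lee_fin le_max lexx.
  - exact: measurable_pospart.
  - apply: filterS (ae_spt mu) => x sx _; rewrite -EFinD lee_fin indicE.
    case: (ltP 0 (h x)) => hx.
      by rewrite mem_set// mulr1 le_max hk ?orbT.
    rewrite memNset/=; first by rewrite mulr0 addr0 le_max lexx.
    by rewrite /S/= => /(le_lt_trans hx); rewrite ltxx.
rewrite leNgt -{1}(adde0 eps%:E) lteD2lE//.
by rewrite mule_gt0.
Qed.

Variables (f g : 'rV[R]_d -> R) (eps L : R).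
Hypothesis eps0 : 0 < eps.
Hypothesis fg : dual_potentials eps mu mu f g.
Hypothesis short : forall x y, spt mu x -> spt mu y ->
  0 < slack f g x y -> enorm (x - y) < L.

Let continuous_slackl y : continuous (slack f g ^~ y).
Proof.
have [cf _ _ _] := fg.
have -> : slack f g ^~ y = slack g f y.
  by apply/funext => x; rewrite /slack costC (addrC (f x)).
exact: continuous_slack.
Qed.

(** The marginal equation for [y] and the one for [y'] integrate to the same
    [eps], so the slack cannot increase by a positive constant wherever it was
    positive; there [|x - y| < L], which controls the change of cost. *)
Lemma potential_growth y y' : spt mu y -> spt mu y' ->
  g y' <= g y + enorm (y - y') * (2 * L + enorm (y - y')) / 2.
Proof.
move=> sy sy'; rewrite -subr_le0.
have [_ _ ig _] := fg.
apply: (pospart_integral_gap (@continuous_slackl y) (@continuous_slackl y') eps0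
  (ig y)); first by rewrite ig.
move=> x sx xy; have := short sx sy xy.
have := enorm_triangle y x y'.
have := enorm_ge0 (y - y'); have := enorm_ge0 (x - y'); have := enorm_ge0 (x - y).
rewrite /slack /cost.
move: (enorm (x - y)) (enorm (x - y')) (enorm (y - y')) => u v w.
move=> u0 v0 w0 vuw uL.
have : v ^+ 2 <= (u + w) ^+ 2 by rewrite ler_pXn2r ?nnegrE ?addr_ge0.
have : u * w <= L * w by rewrite ler_wpM2r// ltW.
lra.
Qed.

(** The point [y] at distance [L] serves as a reference: the slack is nonpositive
    there, and [g] grows by at most [4 L ^ 2] from [y] to [z]. *)
Lemma slack_upper x y z : spt mu x -> spt mu y -> spt mu z ->
  enorm (x - y) = L -> 0 < slack f g x z -> slack f g x z <= 9 / 2 * L ^+ 2.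
Proof.
move=> sx sy sz xy xz.
have yz : enorm (y - z) <= 2 * L.
  have := enorm_triangle x y z; rewrite (enormB y x) xy.
  have := short sx sz xz; lra.
have : slack f g x y <= 0.
  by rewrite leNgt; apply/negP => /(short sx sy); rewrite xy ltxx.
have := potential_growth sy sz.
have := enorm_ge0 (y - z); have := enorm_ge0 (x - z).
move: yz; rewrite /slack /cost xy.
move: (enorm (x - z)) (enorm (y - z)) => u v v2L u0 v0 gz fx.
have : v * (2 * L + v) <= 2 * L * (2 * L + 2 * L).
  by apply: ler_pM; lra.
have := sqr_ge0 u.
nra.
Qed.

(** The slack against [x] is at most [9/2 L ^ 2] and positive only inside the
    ball, so its integral [eps] is at most that bound times the mass. *)
Lemma eps_le_mass x y : spt mu x -> spt mu y -> enorm (x - y) = L ->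
  eps <= 9 / 2 * L ^+ 2 * fine (mu (eball x L)).
Proof.
move=> sx sy xy; have [_ cg _ ifx] := fg.
have mB := open_measurable_rV (@open_eball _ _ x L).
have c0 : 0 <= 9 / 2 * L ^+ 2 by rewrite mulr_ge0// sqr_ge0.
rewrite -lee_fin EFinM fineK ?fin_num_measure// -(ifx x).
have -> : ((9 / 2 * L ^+ 2)%:E * mu (eball x L))%E =
    (\int[mu]_z (9 / 2 * L ^+ 2 * \1_(eball x L) z)%:E)%E.
  under eq_integral do rewrite EFinM.
  by rewrite ge0_integralZl_EFin ?integral_indic ?setIT//; exact/measurable_EFinP.
apply: ae_ge0_le_integral => //.
- by move=> z _; rewrite lee_fin le_max lexx.
- by apply: measurable_pospart; exact: continuous_slack.
- by move=> z _; rewrite lee_fin mulr_ge0.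
- by apply/measurable_EFinP; exact: measurable_funM.
apply: filterS (ae_spt mu) => z sz _; rewrite lee_fin indicE ge_max.
rewrite mulr_ge0//=; have [xz|xz] := ltP 0 (slack f g x z).
  rewrite mem_set ?mulr1; first exact: (slack_upper sx sy sz xy).
  by rewrite /eball/= enormB; exact: short.
by rewrite (le_trans xz)// mulr_ge0.
Qed.

End slack_bounds.

(** * Connectedness and the spread *)

Section spread_bounds.
Context {R : realType} {d : nat}.

(** Some point of [A] is at distance at least [L] from [x], as otherwise [A]
    would have diameter at most [2 L]; the distances to [x] form an interval. *)
Lemma connected_sphere (A : set 'rV[R]_d) x L : connected A -> A x -> 0 <= L ->
  2 * L < diam A -> exists2 y, A y & enorm (x - y) = L.
Proof.
move=> cA Ax L0 Ld.
have [z Az Lz] : exists2 z, A z & L <= enorm (x - z).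
  apply: contrapT => far; have : diam A <= 2 * L.
    apply: ge_sup; first by exists (enorm (x - x)), (x, x).
    move=> _ [[a b]/= [Aa Ab] <-].
    have le c : A c -> enorm (x - c) <= L.
      by move=> Ac; rewrite leNgt; apply/negP => /ltW xc; apply: far; exists c.
    have := enorm_triangle x a b; have := le a Aa; have := le b Ab.
    rewrite (enormB a x); lra.
  by rewrite leNgt Ld.
have cI : connected [set enorm (x - y) | y in A].
  apply: connected_continuous_connected => //; apply: continuous_subspaceT.
  exact: continuous_enorm_sub.
have /connected_intervalP iI := cI.
have [y Ay <-] : [set enorm (x - y) | y in A] L.
  apply: (iI (enorm (x - x)) (enorm (x - z))); [by exists x|by exists z|].
  by rewrite subrr enorm0 L0.
by exists y.
Qed.

(** The radius [9 L ^ 2] is admissible in the infimum: its square root [3 L] is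
    at least [L], and doubling [9/2] makes the inequality strict. *)
Lemma delta_ST_le (mu : probability 'rV[R]_d R) eps L : 0 < eps -> 0 < L ->
  (forall x, spt mu x -> eps <= 9 / 2 * L ^+ 2 * fine (mu (eball x L))) ->
  delta_ST mu eps <= 9 * L ^+ 2.
Proof.
move=> eps0 L0 mass; have L2 : 0 < L ^+ 2 by rewrite exprn_gt0.
apply: ge_inf; first by exists 0 => r [/ltW].
split; first by rewrite mulr_gt0.
have -> : Num.sqrt (9 * L ^+ 2) = 3 * L.
  by rewrite -[9](_ : 3 ^+ 2 = _) ?sqrrM -?exprMn ?sqrtr_sqr ?ger0_norm; [|lra|ring].
have : eps / (9 / 2 * L ^+ 2) <= rho mu (3 * L).
  apply: lb_le_inf; first by have [x sx] := spt_nonempty mu; eexists; exists x.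
  move=> _ [x sx <-]; rewrite ler_pdivrMr ?mulr_gt0//.
  rewrite (le_trans (mass x sx))// mulrC ler_pM2r ?mulr_gt0//.
  rewrite fine_le ?fin_num_measure//; try exact: open_measurable_rV (@open_eball _ _ _ _).
  apply: le_measure; rewrite ?inE; try exact: open_measurable_rV (@open_eball _ _ _ _).
  by move=> y; rewrite /eball/=; lra.
rewrite ler_pdivrMr ?mulr_gt0//; lra.
Qed.
End spread_bounds.

(** * Lower bound on the spread of the regularized plan *)

Section lower_bound.
Context {R : realType} {d : nat} (mu : probability 'rV[R]_d R).

(** If all pairs were closer than the bound [L], then [delta_ST mu eps] would be at
    most [9 L ^ 2], which is less than [delta_ST mu eps] by the choice of 1/10. *)
Lemma qot_spt_spread f g eps : connected (spt mu) -> 0 < eps ->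
  dual_potentials eps mu mu f g ->
  exists x y : 'rV[R]_d, qot_spt mu mu f g (x, y) /\
    Num.sqrt 2 * 10^-1 * Num.min (Num.sqrt (delta_ST mu eps)) (diam (spt mu))
      <= enorm (x - y).
Proof.
move=> conn eps0 fg.
set m := Num.min _ _; set L := Num.sqrt 2 * 10^-1 * m.
have in_spt x y : spt mu x -> spt mu y -> 0 < slack f g x y ->
    qot_spt mu mu f g (x, y).
  move=> sx sy xy; apply: subset_closure; split; first exact: spt_prodP.
  by move: xy; rewrite /slack subr_gt0.
(* Nothing to separate here: any support point has a partner with positive slack. *)
have [L0|L0] := leP L 0.
  have [x sx] := spt_nonempty mu.
  have [_ cg _ ifx] := fg.
  have [|y sy xy] := pospart_integral_witness (mu := mu) (continuous_slack (f := f) (x := x) cg).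
    by rewrite ifx lte_fin.
  exists x, y; split; first exact: in_spt.
  by rewrite (le_trans L0)// enorm_ge0.
apply: contrapT => none.
have short x y : spt mu x -> spt mu y -> 0 < slack f g x y -> enorm (x - y) < L.
  move=> sx sy xy; rewrite ltNge; apply/negP => Lxy; apply: none.
  by exists x, y; split => //; exact: in_spt.
have s2 : 0 < Num.sqrt 2 :> R by rewrite sqrtr_gt0.
have ss2 : Num.sqrt 2 ^+ 2 = 2 :> R by rewrite sqr_sqrtr.
have m0 : 0 < m by move: L0; rewrite pmulr_rgt0// mulr_gt0// invr_gt0.
have Lm2 : L ^+ 2 = 50^-1 * m ^+ 2 by rewrite /L 2!exprMn ss2; field.
have Ldiam : 2 * L < diam (spt mu).
  apply: (@lt_le_trans _ _ m); last by rewrite /m ge_min lexx orbT.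
  rewrite -(@ltr_pXn2r _ 2)// ?nnegrE ?ltW ?mulr_gt0// exprMn Lm2.
  have : 0 < m ^+ 2 by rewrite exprn_gt0.
  lra.
have : delta_ST mu eps <= 9 * L ^+ 2.
  apply: delta_ST_le => // x sx.
  have [y sy xy] := connected_sphere conn sx (ltW L0) Ldiam.
  exact: (eps_le_mass eps0 fg short sx sy xy).
have md : m ^+ 2 <= delta_ST mu eps.
  have md : m <= Num.sqrt (delta_ST mu eps) by rewrite /m ge_min lexx.
  have d0 : 0 < delta_ST mu eps by rewrite -sqrtr_gt0 (lt_le_trans m0).
  rewrite -[leRHS](sqr_sqrtr (ltW d0)).
  by rewrite ler_pXn2r ?nnegrE ?sqrtr_ge0 ?(ltW m0).
have : 0 < m ^+ 2 by rewrite exprn_gt0.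
rewrite Lm2; lra.
Qed.

(** From [|x - y| <= |x - z| + |y - z|] and [(a + b) ^ 2 <= 2 (a ^ 2 + b ^ 2)]. *)
Lemma enorm_sub_le_diag (x y z : 'rV[R]_d) :
  enorm (x - y) <= Num.sqrt 2 * enorm2 ((x, y) - (z, z)).
Proof.
have s2 : Num.sqrt 2 ^+ 2 = 2 :> R by rewrite sqr_sqrtr.
have e2 : enorm2 ((x, y) - (z, z)) ^+ 2 = enorm (x - z) ^+ 2 + enorm (y - z) ^+ 2.
  by rewrite sqr_sqrtr// addr_ge0 ?sqr_ge0.
rewrite -(@ler_pXn2r _ 2) ?nnegrE ?mulr_ge0 ?sqrtr_ge0// exprMn s2 e2.
have := enorm_triangle z x y; rewrite (enormB z y).
have := enorm_ge0 (x - y).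
have := enorm_ge0 (x - z); have := enorm_ge0 (y - z).
move: (enorm (x - y)) (enorm (y - z)) (enorm (x - z)) => u v w v0 w0 u0 uvw.
have : u ^+ 2 <= (w + v) ^+ 2 by rewrite ler_pXn2r ?nnegrE ?addr_ge0.
have := sqr_ge0 (w - v).
lra.
Qed.

End lower_bound.

(* connected (spt mu) is the form in which the connectedness assumption on the
   interior of spt mu has to be used: it follows from it when spt mu is the
   closure of its interior, and the result fails without it (the interior of
   spt mu does not see pieces of spt mu with empty interior). *)
Theorem theorem3p4 (R : realType) (d : nat) (mu : probability 'rV[R]_d R)
  (d_gt0 : (0 < d)%N)
  (mu_ac : mu `<< lebesgue_outer)
  (spt_ball : spt mu `<=` eball 0 1)
  (int_connected : connected (interior (spt mu)))
  (spt_connected : connected (spt mu)) :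
  exists C : R, 0 < C /\
    forall (eps : R), 0 < eps ->
    forall (pi_eps pi_star : probability ('rV[R]_d * 'rV[R]_d)%type R)
      (f g : 'rV[R]_d -> R),
      qot_solution eps mu mu pi_eps f g ->
      ot_plan mu mu pi_star ->
      ((C * Num.min (Num.sqrt (delta_ST mu eps)) (diam (spt mu)))%:E
         <= dist (qot_spt mu mu f g) (spt pi_star))%E /\
      exists x y : 'rV[R]_d,
        qot_spt mu mu f g (x, y) /\
        Num.sqrt 2 * C * Num.min (Num.sqrt (delta_ST mu eps)) (diam (spt mu))
          <= enorm (x - y).
Proof.
exists 10^-1; split; first by rewrite invr_gt0.
move=> eps eps0 pi_eps pi_star f g [_ fg _] opt.
have [x [y [xy far]]] := qot_spt_spread spt_connected eps0 fg.
split; last by exists x, y.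
apply: le_ereal_sup_tmp; exists (ereal_inf [set (enorm2 ((x, y) - b))%:E | b in spt pi_star]).
  by exists (x, y).
apply: le_ereal_inf_tmp => _ [[a b] /(spt_ot_plan_self opt)/= -> <-].
rewrite lee_fin -(@ler_pM2l _ (Num.sqrt 2)) ?sqrtr_gt0// mulrA.
exact: (le_trans far (enorm_sub_le_diag x y b)).
Qed.
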